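(* Let $\Gamma$ be a finitely generated group, let $\Gamma=\Gamma_0\ge\Gamma_1\ge\cdots$ be a chain of normal subgroups of finite index in $\Gamma$, and let $f$ be the boundary action of $\Gamma$ with respect to $(\Gamma_n)$. Then $f$ is strongly ergodic if and only if it has spectral gap.
   Context: A chain in $\Gamma$ is a sequence $\Gamma=\Gamma_0\ge\Gamma_1\ge\cdots$ of finite index subgroups. The coset tree $T(\Gamma,(\Gamma_n))$ has as vertices the right cosets $\Gamma_n g$ ($n\ge0$, $g\in\Gamma$), with $\Gamma_n g$ joined to $\Gamma_{n+1}h$ when $\Gamma_{n+1}h\subseteq\Gamma_n g$; $\Gamma$ acts on it by right multiplication. Its boundary $\partial T$ is the set of infinite rays from the root, with the topology generated by shadows $\mathrm{Sh}(\Gamma_n g)$ (rays through $\Gamma_n g$) and the Borel probability measure $\mu$ with $\mu(\mathrm{Sh}(\Gamma_ng))=1/|\Gamma:\Gamma_n|$. The boundary action is the induced measure preserving action of $\Gamma$ on $(\partial T,\mu)$. An action on $(X,\mu)$ is strongly ergodic if it is ergodic and every sequence $A_n$ of measurable sets with $\mu(A_n\setminus A_n\gamma)\to0$ for all $\gamma$ satisfies $\mu(A_n)(1-\mu(A_n))\to0$. It has spectral gap if there is no sequence $A_n$ of measurable sets of positive measure with $\mu(A_n\gamma\setminus A_n)/\mu(A_n)\to0$ for all $\gamma\in\Gamma$ (equivalently, the Koopman representation on $L^2_0(X,\mu)$ has no almost invariant vectors).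
   Formalization: Spectral gap is taken with sets satisfying 0 < μ(A_n) ≤ 1/2 instead of only positive measure, since the whole space A_n = ∂T would otherwise always violate it and contradict the stated L^2_0 equivalence. *)

(* Defs.v *)
From Stdlib Require Import Reals List ClassicalEpsilon.
Open Scope R_scope.

Record Group := {
  gcarrier :> Type;
  gmul : gcarrier -> gcarrier -> gcarrier;
  ginv : gcarrier -> gcarrier;
  gone : gcarrier;
  gmulA : forall a b c, gmul a (gmul b c) = gmul (gmul a b) c;
  gmul1l : forall a, gmul gone a = a;
  gmul1r : forall a, gmul a gone = a;
  gmulVl : forall a, gmul (ginv a) a = gone;
  gmulVr : forall a, gmul a (ginv a) = gone
}.

Arguments gmul {g}.
Arguments ginv {g}.
Arguments gone {g}.

Definition is_subgroup (G : Group) (H : G -> Prop) : Prop :=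
  H gone /\ (forall a b, H a -> H b -> H (gmul a b)) /\ (forall a, H a -> H (ginv a)).

Definition is_normal (G : Group) (H : G -> Prop) : Prop :=
  forall g h : G, H h -> H (gmul (gmul g h) (ginv g)).

(** [has_index H k] : H has exactly k right cosets H g in G
    (H a = H b iff a b^-1 \in H). *)
Definition has_index (G : Group) (H : G -> Prop) (k : nat) : Prop :=
  exists l : list G, length l = k /\
    (forall g : G, exists r, In r l /\ H (gmul g (ginv r))) /\
    (forall i j, (i < k)%nat -> (j < k)%nat ->
       H (gmul (nth i l gone) (ginv (nth j l gone))) -> i = j).

Definition finite_index (G : Group) (H : G -> Prop) : Prop :=
  exists k, has_index G H k.

(** |G : H| (meaningful when H has finite index). *)
Definition index (G : Group) (H : G -> Prop) : nat :=
  epsilon (inhabits 0%nat) (has_index G H).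

Inductive generated (G : Group) (S : list G) : G -> Prop :=
  | gen_one : generated G S gone
  | gen_mul : forall a s, In s S -> generated G S a -> generated G S (gmul a s)
  | gen_mulV : forall a s, In s S -> generated G S a -> generated G S (gmul a (ginv s)).

Definition finitely_generated (G : Group) : Prop :=
  exists S : list G, forall g : G, generated G S g.

Definition normal_chain (G : Group) (Gam : nat -> G -> Prop) : Prop :=
  (forall g : G, Gam 0%nat g) /\
  (forall n, is_subgroup G (Gam n) /\ is_normal G (Gam n) /\ finite_index G (Gam n)) /\
  (forall n (g : G), Gam (S n) g -> Gam n g).

(** Boundary of the coset tree: a ray is a sequence of cosets
    Γ_n x_n with Γ_{n+1} x_{n+1} ⊆ Γ_n x_n, i.e. x_{n+1} x_n^{-1} ∈ Γ_n.
    We represent it by the sequence of representatives (x_n); two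
    representative sequences give the same ray iff x_n y_n^{-1} ∈ Γ_n for
    all n. All measurable sets (σ-algebra generated by shadows) are
    saturated for this relation, so working with representatives is harmless. *)
Definition ray (G : Group) (Gam : nat -> G -> Prop) : Type :=
  { x : nat -> G | forall n, Gam n (gmul (x (S n)) (ginv (x n))) }.

Lemma gmul_ginv_cancel (G : Group) (a b g : G) :
  gmul (gmul a g) (ginv (gmul b g)) = gmul a (ginv b).
Proof.
  assert (H1 : gmul (gmul b g) (gmul (ginv g) (ginv b)) = gone).
  { rewrite <- gmulA, (gmulA _ g), gmulVr, gmul1l, gmulVr. reflexivity. }
  assert (Hinv : ginv (gmul b g) = gmul (ginv g) (ginv b)).
  { rewrite <- (gmul1r _ (ginv (gmul b g))), <- H1, gmulA, gmulVl, gmul1l.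
    reflexivity. }
  rewrite Hinv, <- gmulA, (gmulA _ g), gmulVr, gmul1l. reflexivity.
Qed.

Definition ract (G : Group) (Gam : nat -> G -> Prop) (x : ray G Gam) (c : G)
  : ray G Gam.
Proof.
  destruct x as [x Hx].
  exists (fun n => gmul (x n) c).
  intro n. rewrite gmul_ginv_cancel. apply Hx.
Defined.

Definition rseq (G : Group) (Gam : nat -> G -> Prop) (x : ray G Gam) : nat -> G :=
  proj1_sig x.

(** Shadow Sh(Γ_n g): rays passing through the vertex Γ_n g. *)
Definition shadow (G : Group) (Gam : nat -> G -> Prop) (n : nat) (g : G)
  : ray G Gam -> Prop :=
  fun x => Gam n (gmul (rseq G Gam x n) (ginv g)).

Definition sigma_algebra (X : Type) (S : (X -> Prop) -> Prop) : Prop :=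
  S (fun _ => True) /\
  (forall A, S A -> S (fun x => ~ A x)) /\
  (forall A : nat -> X -> Prop, (forall i, S (A i)) -> S (fun x => exists i, A i x)).

Definition measurable (G : Group) (Gam : nat -> G -> Prop) (A : ray G Gam -> Prop)
  : Prop :=
  forall S, sigma_algebra (ray G Gam) S -> (forall n g, S (shadow G Gam n g)) -> S A.

(** The measure μ, with μ(Sh(Γ_n g)) = 1/|Γ:Γ_n|, obtained as the
    (Carathéodory) outer measure from countable covers by shadows; on
    measurable sets it is the unique Borel probability measure with the
    prescribed values on shadows. [None] entries are empty pieces (cost 0),
    allowing finite covers. *)
Definition cover_cost (G : Group) (Gam : nat -> G -> Prop) (A : ray G Gam -> Prop)
  (l : R) : Prop :=
  exists c : nat -> option (nat * G),
    (forall x, A x -> exists i n g, c i = Some (n, g) /\ shadow G Gam n g x) /\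
    infinite_sum (fun i => match c i with
                           | None => 0
                           | Some (n, _) => / INR (index G (Gam n))
                           end) l.

Definition is_glb (P : R -> Prop) (m : R) : Prop :=
  (forall s, P s -> m <= s) /\ (forall m', (forall s, P s -> m' <= s) -> m' <= m).

Definition mu (G : Group) (Gam : nat -> G -> Prop) (A : ray G Gam -> Prop) : R :=
  epsilon (inhabits 0) (is_glb (cover_cost G Gam A)).

Definition translate (G : Group) (Gam : nat -> G -> Prop) (A : ray G Gam -> Prop)
  (c : G) : ray G Gam -> Prop :=
  fun x => A (ract G Gam x (ginv c)).

Definition setD {X : Type} (A B : X -> Prop) : X -> Prop := fun x => A x /\ ~ B x.

Definition ergodic (G : Group) (Gam : nat -> G -> Prop) : Prop :=
  forall A : ray G Gam -> Prop, measurable G Gam A ->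
    (forall (c : G) x, translate G Gam A c x <-> A x) ->
    mu G Gam A = 0 \/ mu G Gam A = 1.

Definition strongly_ergodic (G : Group) (Gam : nat -> G -> Prop) : Prop :=
  ergodic G Gam /\
  forall A : nat -> ray G Gam -> Prop,
    (forall k, measurable G Gam (A k)) ->
    (forall c : G, Un_cv (fun k => mu G Gam (setD (A k) (translate G Gam (A k) c))) 0) ->
    Un_cv (fun k => mu G Gam (A k) * (1 - mu G Gam (A k))) 0.

Definition spectral_gap (G : Group) (Gam : nat -> G -> Prop) : Prop :=
  ~ exists A : nat -> ray G Gam -> Prop,
      (forall k, measurable G Gam (A k) /\ 0 < mu G Gam (A k) <= / 2) /\
      (forall c : G,
         Un_cv (fun k => mu G Gam (setD (translate G Gam (A k) c) (A k)) / mu G Gam (A k)) 0).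

(* Main.v *)
Require Import Defs.
From Stdlib Require Import Reals List ClassicalEpsilon.
From Stdlib Require Import Permutation Cantor Lra Lia Bool.
From Stdlib Require Import FunctionalExtensionality PropExtensionality.

(** Since the [Gam n] are normal, [G] also acts on the boundary by left
    multiplication; this action preserves [mu] and commutes with the boundary action.
    Given sets [A_k] violating the spectral gap, approximate [A_k] by a union [B_k] of
    shadows of one level, with error small compared with [mu A_k], and greedily add left
    translates of [B_k] until the union has measure between 1/4 and 5/8.  An averaging
    argument shows that about [1 / mu A_k] translates suffice, and each of them moves no
    more than [B_k] does, so the unions are almost invariant and contradict strong
    ergodicity.  Conversely, almost invariant sets of measure bounded away from 0 and 1,
    replaced by their complements when larger than 1/2, violate the spectral gap. *)

(** * Finite sums *)

Fixpoint rsum {T : Type} (f : T -> R) (l : list T) : R :=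
  match l with
  | nil => 0
  | x :: l' => f x + rsum f l'
  end.

Definition b2R (b : bool) : R := if b then 1 else 0.

Definition decb (P : Prop) : bool :=
  if excluded_middle_informative P then true else false.

Lemma decbP (P : Prop) : decb P = true <-> P.
Proof. unfold decb; destruct excluded_middle_informative; split; easy. Qed.

Lemma decb_eq (P Q : Prop) : (P <-> Q) -> decb P = decb Q.
Proof. intros H. apply eq_iff_eq_true. rewrite !decbP. exact H. Qed.

Lemma b2R_bounds (b : bool) : 0 <= b2R b <= 1.
Proof. destruct b; simpl; lra. Qed.

Lemma rsum_app {T} (f : T -> R) l l' : rsum f (l ++ l') = rsum f l + rsum f l'.
Proof. induction l as [|x l IH]; simpl; lra. Qed.

Lemma rsum_plus {T} (f g : T -> R) l :
  rsum (fun x => f x + g x) l = rsum f l + rsum g l.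
Proof. induction l as [|x l IH]; simpl; lra. Qed.

Lemma rsum_scal {T} (a : R) (f : T -> R) l : rsum (fun x => a * f x) l = a * rsum f l.
Proof. induction l as [|x l IH]; simpl; [|rewrite IH]; ring. Qed.

Lemma rsum_const {T} (a : R) (l : list T) : rsum (fun _ => a) l = a * INR (length l).
Proof.
  induction l as [|x l IH]; [simpl; ring|].
  change (length (x :: l)) with (S (length l)). rewrite S_INR. simpl. rewrite IH. ring.
Qed.

Lemma rsum_le {T} (f g : T -> R) l :
  (forall x, In x l -> f x <= g x) -> rsum f l <= rsum g l.
Proof.
  induction l as [|x l IH]; intros H; simpl; [lra|].
  apply Rplus_le_compat; [apply H; now left|apply IH; intros y Hy; apply H; now right].
Qed.

Lemma rsum_ext {T} (f g : T -> R) l :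
  (forall x, In x l -> f x = g x) -> rsum f l = rsum g l.
Proof. intros H; apply Rle_antisym; apply rsum_le; intros x Hx; rewrite H; auto; lra. Qed.

Lemma rsum_nonneg {T} (f : T -> R) l : (forall x, In x l -> 0 <= f x) -> 0 <= rsum f l.
Proof.
  intros H. replace 0 with (rsum (fun _ : T => 0) l) by (rewrite rsum_const; ring).
  now apply rsum_le.
Qed.

Lemma rsum_map {T U} (h : T -> U) (f : U -> R) l :
  rsum f (map h l) = rsum (fun x => f (h x)) l.
Proof. induction l as [|x l IH]; simpl; [|rewrite IH]; reflexivity. Qed.

Lemma rsum_perm {T} (f : T -> R) l l' : Permutation l l' -> rsum f l = rsum f l'.
Proof. induction 1; simpl; lra. Qed.

Lemma rsum_swap {T U} (f : T -> U -> R) l l' :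
  rsum (fun x => rsum (f x) l') l = rsum (fun y => rsum (fun x => f x y) l) l'.
Proof.
  induction l as [|x l IH]; simpl; [rewrite rsum_const; ring|].
  now rewrite IH, rsum_plus.
Qed.

Lemma rsum_prod {T U} (f : T * U -> R) l l' :
  rsum f (list_prod l l') = rsum (fun x => rsum (fun y => f (x, y)) l') l.
Proof.
  induction l as [|x l IH]; simpl; [reflexivity|].
  now rewrite rsum_app, rsum_map, IH.
Qed.

Lemma rsum_incl {T} (f : T -> R) l l' :
  (forall x, 0 <= f x) -> NoDup l -> incl l l' -> rsum f l <= rsum f l'.
Proof.
  intros Hf; revert l'; induction l as [|x l IH]; intros l' Hnd Hin; simpl.
  - apply rsum_nonneg; auto.
  - inversion_clear Hnd as [|? ? Hx Hnd'].
    destruct (in_split x l') as (l1 & l2 & ->); [apply Hin; now left|].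
    rewrite rsum_app; simpl.
    assert (rsum f l <= rsum f (l1 ++ l2)) as H.
    { apply IH; auto. intros y Hy.
      assert (In y (l1 ++ x :: l2)) as Hy' by (apply Hin; now right).
      rewrite in_app_iff in *; simpl in Hy'.
      destruct Hy' as [|[<-|]]; auto. contradiction. }
    rewrite rsum_app in H. lra.
Qed.

Lemma rsum_single {T} (f : T -> R) l a :
  NoDup l -> In a l -> (forall x, In x l -> x <> a -> f x = 0) -> rsum f l = f a.
Proof.
  intros Hnd Ha H.
  destruct (in_split a l Ha) as (l1 & l2 & ->).
  rewrite rsum_app; simpl.
  apply NoDup_remove_2 in Hnd.
  rewrite (rsum_ext f (fun _ => 0) l1), (rsum_ext f (fun _ => 0) l2), !rsum_const; [ring| |].
  - intros x Hx; apply H; [rewrite in_app_iff; simpl; auto|].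
    intros ->; apply Hnd; rewrite in_app_iff; auto.
  - intros x Hx; apply H; [rewrite in_app_iff; simpl; auto|].
    intros ->; apply Hnd; rewrite in_app_iff; auto.
Qed.

Lemma sum_f_R0_rsum (f : nat -> R) n : sum_f_R0 f n = rsum f (seq 0 (S n)).
Proof.
  induction n as [|n IH]; [simpl; ring|].
  rewrite seq_S, rsum_app, <- IH. simpl. ring.
Qed.

Lemma half_pow_sum (n : nat) : rsum (fun i => (/ 2) ^ S i) (seq 0 n) <= 1.
Proof.
  assert (rsum (fun i => (/ 2) ^ S i) (seq 0 n) = 1 - (/ 2) ^ n) as ->.
  { induction n as [|n IH]; [simpl; ring|].
    rewrite seq_S, rsum_app, IH. simpl. lra. }
  assert (0 < (/ 2) ^ n) by (apply pow_lt; lra). lra.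
Qed.

(** Take the maximum of the finitely many thresholds. This is the finiteness step of the compactness
    arguments on the coset tree. *)
Lemma eventually_uniform_list {T} (Q : nat -> T -> Prop) (l : list T) :
  (forall N M x, (N <= M)%nat -> Q N x -> Q M x) ->
  (forall x, In x l -> exists N, Q N x) ->
  exists N, forall x, In x l -> Q N x.
Proof.
  intros Hmon. induction l as [|a l IH]; intros H.
  - exists 0%nat; intros x [].
  - destruct IH as [N HN]; [intros x Hx; apply H; now right|].
    destruct (H a) as [M HM]; [now left|].
    exists (Nat.max N M). intros x [<-|Hx].
    + apply (Hmon M); [lia|auto].
    + apply (Hmon N); [lia|auto].
Qed.

Lemma bounded_increments_tail (u : nat -> R) (b : R) (e : R) :
  (forall n, u n <= u (S n)) -> (forall n, u n <= b) -> 0 < e ->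
  exists N, forall M, (N <= M)%nat -> u M - u N <= e.
Proof.
  intros Hm Hb He.
  destruct (growing_cv u) as [l Hl].
  - exact Hm.
  - exists b. intros x [n ->]. apply Hb.
  - destruct (Hl e He) as [N HN]. exists N. intros M HM.
    assert (u M <= l) by (apply growing_ineq; auto).
    specialize (HN N (le_n N)). unfold Rdist in HN.
    apply Rabs_def2 in HN. lra.
Qed.

Section Chain.
Variables (G : Group) (Gam : nat -> G -> Prop).
Hypothesis chain : normal_chain G Gam.

(** * Cosets *)

Lemma ginv_gmul (a b : G) : ginv (gmul a b) = gmul (ginv b) (ginv a).
Proof.
  rewrite <- (gmul1r _ (ginv (gmul a b))).
  assert (gmul (gmul a b) (gmul (ginv b) (ginv a)) = gone) as <-.
  { now rewrite <- gmulA, (gmulA _ b), gmulVr, gmul1l, gmulVr. }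
  now rewrite gmulA, gmulVl, gmul1l.
Qed.

Lemma ginv_invol (a : G) : ginv (ginv a) = a.
Proof.
  rewrite <- (gmul1r _ (ginv (ginv a))), <- (gmulVl _ a).
  now rewrite gmulA, gmulVl, gmul1l.
Qed.

Definition coset_eq (n : nat) (a b : G) : Prop := Gam n (gmul a (ginv b)).

Lemma coset_eq_refl n a : coset_eq n a a.
Proof.
  unfold coset_eq. rewrite gmulVr. destruct chain as (_ & H & _).
  now destruct (H n) as ((H1 & _) & _).
Qed.

Lemma coset_eq_sym n a b : coset_eq n a b -> coset_eq n b a.
Proof.
  unfold coset_eq. destruct chain as (_ & H & _). destruct (H n) as ((_ & _ & Hi) & _).
  intros Hab. apply Hi in Hab. now rewrite ginv_gmul, ginv_invol in Hab.
Qed.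

Lemma coset_eq_trans n a b c : coset_eq n a b -> coset_eq n b c -> coset_eq n a c.
Proof.
  unfold coset_eq. destruct chain as (_ & H & _). destruct (H n) as ((_ & Hm & _) & _).
  intros Hab Hbc. specialize (Hm _ _ Hab Hbc).
  now rewrite <- gmulA, (gmulA _ (ginv b)), gmulVl, gmul1l in Hm.
Qed.

Lemma coset_eq_mulr n a b c : coset_eq n (gmul a c) (gmul b c) <-> coset_eq n a b.
Proof. unfold coset_eq. now rewrite gmul_ginv_cancel. Qed.

(** This is where normality enters: [c a (c b)^-1] is the conjugate of [a b^-1] by [c]. It makes
    left multiplication act on right cosets. *)
Lemma coset_eq_mull n a b c : coset_eq n a b -> coset_eq n (gmul c a) (gmul c b).
Proof.
  unfold coset_eq. destruct chain as (_ & H & _). destruct (H n) as (_ & Hn & _).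
  intros Hab. apply (Hn c) in Hab. now rewrite ginv_gmul, gmulA, <- (gmulA _ c a).
Qed.

Lemma coset_eq_inv n a b : coset_eq n a b -> coset_eq n (ginv a) (ginv b).
Proof.
  intros H. apply (coset_eq_mull _ _ _ (ginv a)) in H.
  rewrite gmulVl in H. apply (coset_eq_mulr _ _ _ (ginv b)) in H.
  rewrite gmul1l, <- gmulA, gmulVr, gmul1r in H. now apply coset_eq_sym.
Qed.

Lemma coset_eq_le n m a b : (n <= m)%nat -> coset_eq m a b -> coset_eq n a b.
Proof.
  destruct chain as (_ & _ & H). unfold coset_eq.
  induction 1; auto.
Qed.

(** The conditions repeat the body of [has_index] at the value [index], so the chosen list is a
    transversal of exactly that length. *)
Definition reps (n : nat) : list G :=
  epsilon (inhabits nil) (fun l => length l = index G (Gam n) /\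
    (forall g : G, exists r, In r l /\ Gam n (gmul g (ginv r))) /\
    (forall i j, (i < index G (Gam n))%nat -> (j < index G (Gam n))%nat ->
       Gam n (gmul (nth i l gone) (ginv (nth j l gone))) -> i = j)).

Lemma reps_spec n : length (reps n) = index G (Gam n) /\
    (forall g : G, exists r, In r (reps n) /\ coset_eq n g r) /\
    (forall i j, (i < index G (Gam n))%nat -> (j < index G (Gam n))%nat ->
       coset_eq n (nth i (reps n) gone) (nth j (reps n) gone) -> i = j).
Proof.
  unfold reps. apply epsilon_spec.
  assert (has_index G (Gam n) (index G (Gam n))) as H; [|exact H].
  unfold index. apply epsilon_spec. destruct chain as (_ & H & _).
  now destruct (H n) as (_ & _ & Hf).
Qed.

Lemma reps_cover n g : exists r, In r (reps n) /\ coset_eq n g r.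
Proof. apply reps_spec. Qed.

Lemma reps_inj n r s : In r (reps n) -> In s (reps n) -> coset_eq n r s -> r = s.
Proof.
  intros Hr Hs H. destruct (reps_spec n) as (Hl & _ & Hu).
  destruct (In_nth _ _ gone Hr) as (i & Hi & <-).
  destruct (In_nth _ _ gone Hs) as (j & Hj & <-).
  rewrite Hl in *. now rewrite (Hu i j).
Qed.

Lemma reps_NoDup n : NoDup (reps n).
Proof.
  destruct (reps_spec n) as (Hl & _ & Hu).
  rewrite (NoDup_nth _ gone). intros i j Hi Hj H. rewrite Hl in *.
  apply Hu; auto. rewrite H. apply coset_eq_refl.
Qed.

Lemma index_pos n : 0 < INR (index G (Gam n)).
Proof.
  rewrite <- (proj1 (reps_spec n)). destruct (reps_cover n gone) as (r & Hr & _).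
  destruct (reps n); [destruct Hr|]. apply lt_0_INR; simpl; lia.
Qed.

Definition coset_rep (n : nat) (g : G) : G :=
  epsilon (inhabits gone) (fun r => In r (reps n) /\ coset_eq n g r).

Lemma coset_rep_spec n g : In (coset_rep n g) (reps n) /\ coset_eq n g (coset_rep n g).
Proof. unfold coset_rep. apply epsilon_spec. apply reps_cover. Qed.

(** Such functions are those that factor through the finite quotient of [G] by [Gam n]. The codomain
    is left open because both boolean and real functions occur. *)
Definition invariant {T : Type} (n : nat) (f : G -> T) : Prop :=
  forall a b, coset_eq n a b -> f a = f b.

Lemma invariant_le {T} n m (f : G -> T) : (n <= m)%nat -> invariant n f -> invariant m f.
Proof. intros Hnm Hf a b H. apply Hf. eapply coset_eq_le; eauto. Qed.

Lemma invariant_mulr {T} n (f : G -> T) c :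
  invariant n f -> invariant n (fun g => f (gmul g c)).
Proof. intros Hf a b H. apply Hf. now apply coset_eq_mulr. Qed.

Lemma invariant_mull {T} n (f : G -> T) c :
  invariant n f -> invariant n (fun g => f (gmul c g)).
Proof. intros Hf a b H. apply Hf. now apply coset_eq_mull. Qed.

Lemma coset_indicator_invariant n h : invariant n (fun g => decb (coset_eq n g h)).
Proof.
  intros a b H. apply decb_eq. split; apply coset_eq_trans; auto.
  now apply coset_eq_sym.
Qed.

(** * Averages over the cosets of a level *)

(** For an invariant [f] this is the integral over the finite quotient with its uniform probability
    measure. *)
Definition avg (n : nat) (f : G -> R) : R := rsum f (reps n) / INR (index G (Gam n)).

Lemma avg_le n f g : (forall x, f x <= g x) -> avg n f <= avg n g.
Proof.
  intros H. apply Rmult_le_compat_r.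
  - apply Rlt_le, Rinv_0_lt_compat, index_pos.
  - apply rsum_le; auto.
Qed.

Lemma avg_ext n f g : (forall x, f x = g x) -> avg n f = avg n g.
Proof. intros H. apply Rle_antisym; apply avg_le; intros x; rewrite H; lra. Qed.

Lemma avg_plus n f g : avg n (fun x => f x + g x) = avg n f + avg n g.
Proof. unfold avg. rewrite rsum_plus. unfold Rdiv. ring. Qed.

Lemma avg_scal n a f : avg n (fun x => a * f x) = a * avg n f.
Proof. unfold avg. rewrite rsum_scal. unfold Rdiv. ring. Qed.

Lemma avg_const n a : avg n (fun _ => a) = a.
Proof.
  unfold avg. rewrite rsum_const, (proj1 (reps_spec n)).
  field. apply Rgt_not_eq, index_pos.
Qed.

Lemma avg_minus n f g : avg n (fun x => f x - g x) = avg n f - avg n g.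
Proof.
  replace (avg n f - avg n g) with (avg n f + (-1) * avg n g) by ring.
  rewrite <- avg_scal, <- avg_plus. apply avg_ext; intros; ring.
Qed.

Lemma avg_rsum {T} n (f : T -> G -> R) l :
  avg n (fun x => rsum (fun i => f i x) l) = rsum (fun i => avg n (f i)) l.
Proof.
  induction l as [|i l IH]; simpl; [apply avg_const|].
  now rewrite avg_plus, IH.
Qed.

Lemma avg_swap n m (f : G -> G -> R) :
  avg n (fun x => avg m (f x)) = avg m (fun y => avg n (fun x => f x y)).
Proof.
  unfold avg, Rdiv.
  rewrite (rsum_ext _ (fun x => / INR (index G (Gam m)) * rsum (f x) (reps m)) (reps n))
    by (intros; ring).
  rewrite (rsum_ext _
    (fun y => / INR (index G (Gam n)) * rsum (fun x => f x y) (reps n)) (reps m))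
    by (intros; ring).
  rewrite !rsum_scal, rsum_swap. ring.
Qed.

(** An injective self-map of a finite set is a permutation: [x] goes to the representative of
    [phi x], and the terms of the sum are merely reordered. *)
Lemma avg_reindex n (phi : G -> G) f :
  (forall a b, coset_eq n (phi a) (phi b) -> coset_eq n a b) ->
  invariant n f -> avg n (fun x => f (phi x)) = avg n f.
Proof.
  intros Hphi Hf. unfold avg. f_equal.
  rewrite (rsum_ext _ (fun x => f (coset_rep n (phi x))) (reps n)).
  2:{ intros x _. apply Hf. apply coset_rep_spec. }
  rewrite <- (rsum_map (fun x => coset_rep n (phi x)) f). apply rsum_perm.
  apply NoDup_Permutation_bis.
  - apply NoDup_map_NoDup_ForallPairs; [|apply reps_NoDup].
    intros a b Ha Hb Hab. apply (reps_inj n); auto. apply Hphi.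
    eapply coset_eq_trans; [apply coset_rep_spec|]. rewrite Hab.
    apply coset_eq_sym, coset_rep_spec.
  - rewrite length_map. auto.
  - intros x Hx. apply in_map_iff in Hx. destruct Hx as (y & <- & _).
    apply coset_rep_spec.
Qed.

Lemma avg_mulr n f c : invariant n f -> avg n (fun x => f (gmul x c)) = avg n f.
Proof. apply (avg_reindex n (fun x => gmul x c)). intros a b. apply coset_eq_mulr. Qed.

Lemma avg_mull n f c : invariant n f -> avg n (fun x => f (gmul c x)) = avg n f.
Proof.
  apply (avg_reindex n (fun x => gmul c x)). intros a b H.
  apply (coset_eq_mull _ _ _ (ginv c)) in H. now rewrite !gmulA, gmulVl, !gmul1l in H.
Qed.

Lemma avg_inv_mulr n f c : invariant n f -> avg n (fun x => f (gmul (ginv x) c)) = avg n f.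
Proof.
  apply (avg_reindex n (fun x => gmul (ginv x) c)). intros a b H.
  apply coset_eq_mulr, coset_eq_inv in H. now rewrite !ginv_invol in H.
Qed.

Lemma rsum_coset_indicator n (f : G -> R) g : invariant n f ->
  rsum (fun s => b2R (decb (coset_eq n g s)) * f s) (reps n) = f g.
Proof.
  intros Hf. destruct (reps_cover n g) as (r & Hr & Hgr).
  rewrite (rsum_single _ _ r); auto using reps_NoDup.
  - rewrite (proj2 (decbP _) Hgr), (Hf _ _ Hgr). simpl; ring.
  - intros x Hx Hne. destruct (decb (coset_eq n g x)) eqn:Hd; [|simpl; ring].
    exfalso; apply Hne, (reps_inj n); auto. rewrite decbP in Hd.
    apply coset_eq_trans with g; [now apply coset_eq_sym|assumption].
Qed.

(** Right translation makes all cosets of level [n] equally frequent at level [m], and their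
    indicators add up to 1. This replaces a count of the cosets of [Gam m] inside a coset of
    [Gam n]. *)
Lemma avg_coset_indicator_le n m h : (n <= m)%nat ->
  avg m (fun g => b2R (decb (coset_eq n g h))) = / INR (index G (Gam n)).
Proof.
  intros Hnm.
  assert (forall s, avg m (fun g => b2R (decb (coset_eq n g s))) =
                    avg m (fun g => b2R (decb (coset_eq n g gone)))) as Htr.
  { intros s. rewrite <- (avg_mulr m _ s).
    - apply avg_ext; intros g. f_equal. apply decb_eq.
      rewrite <- (coset_eq_mulr n g gone s), gmul1l. reflexivity.
    - intros a b H. f_equal. revert a b H. 
      apply (invariant_le n m); auto. apply coset_indicator_invariant. }
  pose proof (avg_const m 1) as H1.
  rewrite (avg_ext m _ (fun g => rsum (fun s => b2R (decb (coset_eq n g s))) (reps n))) in H1.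
  2:{ intros g. rewrite <- (rsum_coset_indicator n (fun _ => 1) g) by easy.
      apply rsum_ext; intros; ring. }
  rewrite avg_rsum in H1.
  rewrite (rsum_ext _ (fun _ => avg m (fun g => b2R (decb (coset_eq n g h))))) in H1.
  2:{ intros s _. rewrite Htr, <- (Htr h). reflexivity. }
  rewrite rsum_const, (proj1 (reps_spec n)) in H1.
  apply Rmult_eq_reg_r with (INR (index G (Gam n))); [|apply Rgt_not_eq, index_pos].
  rewrite Rinv_l; [exact H1|apply Rgt_not_eq, index_pos].
Qed.

(** Write [f] as a linear combination of indicators of cosets of level [n], whose averages are the
    same at both levels. *)
Lemma avg_level n m f : (n <= m)%nat -> invariant n f -> avg m f = avg n f.
Proof.
  intros Hnm Hf.
  rewrite (avg_ext m f (fun g => rsum (fun s => b2R (decb (coset_eq n g s)) * f s) (reps n)))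
    by (intros g; now rewrite rsum_coset_indicator).
  rewrite avg_rsum.
  rewrite (rsum_ext _ (fun s => / INR (index G (Gam n)) * f s)).
  - rewrite rsum_scal. unfold avg, Rdiv. ring.
  - intros s _.
    rewrite (avg_ext m _ (fun g => f s * b2R (decb (coset_eq n g s)))) by (intros; ring).
    rewrite avg_scal, avg_coset_indicator_le by auto. ring.
Qed.

(** * The outer measure *)

Local Notation bdry := (ray G Gam).
Local Notation "x .[ n ]" := (rseq G Gam x n) (at level 2, n at level 200).

Definition piece (o : option (nat * G)) : bdry -> Prop :=
  match o with None => fun _ => False | Some (n, g) => shadow G Gam n g end.

Definition cost (o : option (nat * G)) : R :=
  match o with None => 0 | Some (n, _) => / INR (index G (Gam n)) end.

(** A variant of [cover_cost] that bounds all partial sums instead of naming the exact sum. It is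
    monotone in [r], so covers can be combined without convergence arguments. *)
Definition covered (A : bdry -> Prop) (r : R) : Prop :=
  exists c : nat -> option (nat * G),
    (forall x, A x -> exists i, piece (c i) x) /\
    (forall n, rsum (fun i => cost (c i)) (seq 0 n) <= r).

Lemma cost_nonneg o : 0 <= cost o.
Proof.
  destruct o as [[n g]|]; simpl; [|lra]. apply Rlt_le, Rinv_0_lt_compat, index_pos.
Qed.

Lemma piece_iff o x : piece o x <-> exists n g, o = Some (n, g) /\ shadow G Gam n g x.
Proof.
  destruct o as [[n g]|]; simpl; split; try easy.
  - intros H; now exists n, g.
  - intros (n' & g' & [= <- <-] & H); exact H.
  - intros (? & ? & ? & _); easy.
Qed.

Lemma covered_nonneg A r : covered A r -> 0 <= r.
Proof. intros (c & _ & H). apply (H 0%nat). Qed.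

Lemma covered_sub (A B : bdry -> Prop) r s :
  (forall x, A x -> B x) -> r <= s -> covered B r -> covered A s.
Proof.
  intros HAB Hrs (c & Hc & H). exists c; split; auto. intros n. specialize (H n); lra.
Qed.

Lemma covered_empty : covered (fun _ => False) 0.
Proof.
  exists (fun _ => None). split; [intros x []|]. intros n; simpl. rewrite rsum_const. lra.
Qed.

Lemma covered_shadow n g : covered (shadow G Gam n g) (/ INR (index G (Gam n))).
Proof.
  exists (fun i => if Nat.eqb i 0 then Some (n, g) else None). split.
  - intros x Hx. now exists 0%nat.
  - intros [|m].
    + simpl. apply Rlt_le, Rinv_0_lt_compat, index_pos.
    + simpl. rewrite (rsum_ext _ (fun _ => 0)); [rewrite rsum_const; lra|].
      intros i Hi. apply in_seq in Hi. destruct i; [lia|reflexivity].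
Qed.

(** The chosen covers are merged along the Cantor pairing. The first [n] pairs lie in the square of
    side [n], so each partial sum is bounded by [n] row sums. *)
Lemma covered_union (A : nat -> bdry -> Prop) (r : nat -> R) (s : R) :
  (forall i, covered (A i) (r i)) -> (forall n, rsum r (seq 0 n) <= s) ->
  covered (fun x => exists i, A i x) s.
Proof.
  intros HA Hr.
  destruct (ClassicalEpsilon.choice _ HA) as (c & Hc).
  exists (fun k => c (fst (of_nat k)) (snd (of_nat k))). split.
  - intros x (i & Hx). destruct (proj1 (Hc i) x Hx) as (j & Hj).
    exists (to_nat (i, j)). now rewrite cancel_of_to.
  - intros n.
    set (F := fun p : nat * nat => cost (c (fst p) (snd p))).
    rewrite <- (rsum_map of_nat F).
    apply Rle_trans with (rsum F (list_prod (seq 0 n) (seq 0 n))).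
    + apply rsum_incl; [intros; apply cost_nonneg| |].
      * apply NoDup_map_NoDup_ForallPairs; [|apply seq_NoDup].
        intros a b _ _ H. rewrite <- (cancel_to_of a), H. apply cancel_to_of.
      * intros [i j] H. apply in_map_iff in H. destruct H as (k & Hk & Hkn).
        apply in_seq in Hkn.
        pose proof (to_nat_non_decreasing i j) as Hij.
        rewrite <- Hk, cancel_to_of in Hij.
        apply in_prod; apply in_seq; lia.
    + rewrite rsum_prod. eapply Rle_trans; [|apply (Hr n)].
      apply rsum_le. intros i _. apply (proj2 (Hc i)).
Qed.

Lemma covered_union2 (A B : bdry -> Prop) r s :
  covered A r -> covered B s -> covered (fun x => A x \/ B x) (r + s).
Proof.
  intros HA HB.
  pose proof (covered_nonneg _ _ HA). pose proof (covered_nonneg _ _ HB).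
  apply (covered_sub _ (fun x => exists i : nat,
      match i with 0%nat => A | 1%nat => B | _ => fun _ => False end x) (r + s)); [|lra|].
  - intros x [Hx|Hx]; [exists 0%nat|exists 1%nat]; exact Hx.
  - apply (covered_union _ (fun i => match i with 0%nat => r | 1%nat => s | _ => 0 end)).
    + intros [|[|i]]; auto using covered_empty.
    + intros [|[|n]]; simpl; [lra|lra|].
      rewrite (rsum_ext _ (fun _ => 0)); [rewrite rsum_const; lra|].
      intros i Hi. apply in_seq in Hi. destruct i as [|[|i]]; [lia|lia|reflexivity].
Qed.

Lemma cost_le_covered A l : cover_cost G Gam A l -> covered A l.
Proof.
  intros (c & Hc & Hl). exists c. split.
  - intros x Hx. destruct (Hc x Hx) as (i & H). exists i. now apply piece_iff.
  - intros n.
    assert (Un_growing (sum_f_R0 (fun i => cost (c i)))) as Hg.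
    { intros m. simpl. pose proof (cost_nonneg (c (S m))). lra. }
    pose proof (growing_ineq _ l Hg Hl n) as H.
    rewrite sum_f_R0_rsum, seq_S, rsum_app in H. simpl in H.
    pose proof (cost_nonneg (c n)). lra.
Qed.

Lemma covered_cost_le A r : covered A r -> exists l, cover_cost G Gam A l /\ l <= r.
Proof.
  intros (c & Hc & Hr).
  assert (forall n, sum_f_R0 (fun i => cost (c i)) n <= r) as Hb.
  { intros n. rewrite sum_f_R0_rsum. apply Hr. }
  destruct (growing_cv (sum_f_R0 (fun i => cost (c i)))) as (l & Hl).
  - intros m. simpl. pose proof (cost_nonneg (c (S m))). lra.
  - exists r. intros x (n & ->). apply Hb.
  - exists l. split.
    + exists c. split; [|exact Hl]. intros x Hx. destruct (Hc x Hx) as (i & H).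
      exists i. now apply piece_iff.
    + refine (@Rle_cv_lim _ (fun _ => r) _ _ Hb Hl _). intros e He. exists 0%nat.
      intros n _. unfold Rdist. rewrite Rminus_diag, Rabs_R0. exact He.
Qed.

Lemma covered_full A : covered A (/ INR (index G (Gam 0%nat))).
Proof.
  apply (covered_sub _ (shadow G Gam 0 gone) (/ INR (index G (Gam 0%nat)))); [|lra|].
  - intros x _. apply (proj1 chain).
  - apply covered_shadow.
Qed.

(** The value chosen by epsilon is a genuine infimum: the costs are bounded below by 0 and the root
    shadow provides one, so completeness applies to their negatives. *)
Lemma mu_glb A : is_glb (cover_cost G Gam A) (mu G Gam A).
Proof.
  unfold mu. apply epsilon_spec.
  destruct (completeness (fun r => cover_cost G Gam A (- r))) as (m & Hub & Hlub).
  - exists 0. intros r Hr. apply cost_le_covered, covered_nonneg in Hr. lra.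
  - destruct (covered_cost_le A _ (covered_full A)) as (l & Hl & _).
    exists (- l). now rewrite Ropp_involutive.
  - exists (- m). split.
    + intros s Hs. assert (- s <= m); [|lra].
      apply Hub. now rewrite Ropp_involutive.
    + intros m' Hm'. assert (m <= - m'); [|lra].
      apply Hlub. intros r Hr. apply Hm' in Hr. lra.
Qed.

Lemma mu_le A r : covered A r -> mu G Gam A <= r.
Proof.
  intros H. destruct (covered_cost_le A r H) as (l & Hl & Hlr).
  apply (proj1 (mu_glb A)) in Hl. lra.
Qed.

Lemma covered_gt A r : mu G Gam A < r -> covered A r.
Proof.
  intros H. destruct (excluded_middle_informative (covered A r)) as [|Hn]; auto.
  exfalso. apply (Rlt_not_le _ _ H). apply (proj2 (mu_glb A)). intros s Hs.
  destruct (Rle_dec r s) as [|Hs']; auto. exfalso; apply Hn.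
  apply (covered_sub _ A s); auto; [lra|now apply cost_le_covered].
Qed.

Lemma le_mu A r : (forall s, covered A s -> r <= s) -> r <= mu G Gam A.
Proof.
  intros H. apply le_epsilon. intros e He. apply H, covered_gt. lra.
Qed.

Lemma mu_nonneg A : 0 <= mu G Gam A.
Proof. apply le_mu. intros s. apply covered_nonneg. Qed.

Lemma mu_mono (A B : bdry -> Prop) : (forall x, A x -> B x) -> mu G Gam A <= mu G Gam B.
Proof.
  intros H. apply le_mu. intros s Hs. apply mu_le. apply (covered_sub _ B s); auto; lra.
Qed.

Lemma mu_ext (A B : bdry -> Prop) : (forall x, A x <-> B x) -> mu G Gam A = mu G Gam B.
Proof. intros H. apply Rle_antisym; apply mu_mono; apply H. Qed.

Lemma mu_union (A B : bdry -> Prop) :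
  mu G Gam (fun x => A x \/ B x) <= mu G Gam A + mu G Gam B.
Proof.
  apply le_epsilon. intros e He.
  replace (mu G Gam A + mu G Gam B + e) with
    ((mu G Gam A + e / 2) + (mu G Gam B + e / 2)) by lra.
  apply mu_le, covered_union2; apply covered_gt; lra.
Qed.

Lemma mu_sub_union (A B C : bdry -> Prop) : (forall x, A x -> B x \/ C x) ->
  mu G Gam A <= mu G Gam B + mu G Gam C.
Proof. intros H. eapply Rle_trans; [|apply mu_union]. now apply mu_mono. Qed.

(** * Translates of boundary sets *)

Lemma ray_eq (x y : bdry) : (forall n, x.[n] = y.[n]) -> x = y.
Proof.
  intros H. destruct x as [x Hx], y as [y Hy]. simpl in H.
  assert (x = y) as -> by (apply functional_extensionality; exact H).
  f_equal. apply proof_irrelevance.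
Qed.

Lemma rseq_ract x c n : (ract G Gam x c).[n] = gmul (x.[n]) c.
Proof. destruct x; reflexivity. Qed.

(** Translating every shadow of a cover keeps its level and hence its cost. *)
Lemma mu_translate_le A c : mu G Gam (translate G Gam A c) <= mu G Gam A.
Proof.
  apply le_mu. intros s (d & Hd & Hs). apply mu_le.
  exists (fun i => match d i with None => None | Some (n, g) => Some (n, gmul g c) end).
  split.
  - intros x Hx. destruct (Hd _ Hx) as (i & Hi). exists i.
    destruct (d i) as [[n g]|]; [|exact Hi].
    simpl in *. unfold shadow in *. rewrite rseq_ract in Hi.
    apply (coset_eq_mulr n _ _ (ginv c)).
    now rewrite <- (gmulA _ g), gmulVr, gmul1r.
  - intros n. eapply Rle_trans; [|apply (Hs n)]. apply rsum_le.
    intros i _. destruct (d i) as [[m g]|]; simpl; lra.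
Qed.

Lemma translate_translate A c d x :
  translate G Gam (translate G Gam A c) d x <-> translate G Gam A (gmul c d) x.
Proof.
  unfold translate. assert (ract G Gam (ract G Gam x (ginv d)) (ginv c) =
                            ract G Gam x (ginv (gmul c d))) as ->; [|tauto].
  apply ray_eq. intros n. now rewrite !rseq_ract, ginv_gmul, gmulA.
Qed.

Lemma translate_one A x : translate G Gam A gone x <-> A x.
Proof.
  unfold translate. assert (ract G Gam x (ginv gone) = x) as ->; [|tauto].
  apply ray_eq. intros n. rewrite rseq_ract.
  now rewrite <- (gmul1l _ (ginv gone)), gmulVr, gmul1r.
Qed.

Lemma mu_translate A c : mu G Gam (translate G Gam A c) = mu G Gam A.
Proof.
  apply Rle_antisym; [apply mu_translate_le|].
  rewrite <- (mu_translate_le (translate G Gam A c) (ginv c)).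
  apply mu_mono. intros x Hx. apply translate_translate. rewrite gmulVr.
  now apply translate_one.
Qed.

(** Translate by [ginv c]. This links the two forms of almost invariance, the one in strong
    ergodicity and the one in spectral gap. *)
Lemma mu_setD_translate A c :
  mu G Gam (setD A (translate G Gam A c)) =
  mu G Gam (setD (translate G Gam A (ginv c)) A).
Proof.
  rewrite <- (mu_translate _ (ginv c)). apply mu_ext. intros x.
  assert (translate G Gam (setD A (translate G Gam A c)) (ginv c) x <->
    translate G Gam A (ginv c) x /\ ~ translate G Gam (translate G Gam A c) (ginv c) x)
    as -> by reflexivity.
  rewrite translate_translate, gmulVr, translate_one. reflexivity.
Qed.

(** * Cylinders and approximation of measurable sets *)

Lemma rseq_coset_le x n m : (n <= m)%nat -> coset_eq n (x.[m]) (x.[n]).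
Proof.
  induction 1 as [|m Hm IH]; [apply coset_eq_refl|].
  apply coset_eq_trans with (x.[m]); auto.
  apply (coset_eq_le n m); auto. exact (proj2_sig x m).
Qed.

(* Koenig's lemma: following successive vertices whose shadow is not finitely
   covered would produce a ray lying in no piece. *)
Lemma finite_subcover (c : nat -> option (nat * G)) :
  (forall x, exists i, piece (c i) x) ->
  exists N, forall x, exists i, (i < N)%nat /\ piece (c i) x.
Proof.
  intros Hc.
  set (fin := fun N n g => forall x, shadow G Gam n g x ->
                           exists i, (i < N)%nat /\ piece (c i) x).
  destruct (classic (exists N, fin N 0%nat gone)) as [[N HN]|Hroot].
  { exists N. intros x. apply HN. apply (proj1 chain). }
  exfalso.
  (* If every child of a vertex had a finitely covered shadow, the maximum of the finitely many
     bounds would serve the vertex itself. The premise sits under the existential so that choice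
     yields a total successor function. *)
  assert (forall n g, exists g', ~ (exists N, fin N n g) ->
            coset_eq n g' g /\ ~ (exists N, fin N (S n) g')) as Hstep.
  { intros n g.
    destruct (classic (exists g', coset_eq n g' g /\ ~ (exists N, fin N (S n) g')))
      as [[g' Hg']|Hno]; [now exists g'|].
    exists gone. intros Hng. exfalso; apply Hng.
    destruct (eventually_uniform_list (fun N r => coset_eq n r g -> fin N (S n) r)
                (reps (S n))) as [N HN].
    - intros N M r HNM H Hr x Hx. destruct (H Hr x Hx) as (i & Hi & Hp).
      exists i; split; [lia|exact Hp].
    - intros r _. destruct (classic (coset_eq n r g)) as [Hr|Hr].
      + destruct (classic (exists N, fin N (S n) r)) as [[N HN]|HN].
        * exists N; auto.
        * exfalso; apply Hno. now exists r.
      + exists 0%nat. intros Hr'; contradiction.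
    - exists N. intros x Hx.
      destruct (reps_cover (S n) (x.[S n])) as (r & Hr & Hxr).
      apply (HN r Hr); [|exact Hxr].
      apply coset_eq_trans with (x.[S n]).
      + apply coset_eq_sym. now apply (coset_eq_le n (S n)); [lia|].
      + apply coset_eq_trans with (x.[n]); [apply rseq_coset_le; lia|exact Hx]. }
  destruct (ClassicalEpsilon.choice (fun p q => ~ (exists N, fin N (fst p) (snd p)) ->
      fst q = S (fst p) /\ coset_eq (fst p) (snd q) (snd p) /\
      ~ (exists N, fin N (fst q) (snd q)))) as (nxt & Hnxt).
  { intros [n g]. destruct (Hstep n g) as (g' & Hg'). exists (S n, g'). simpl. tauto. }
  set (v := fix v n := match n with 0%nat => (0%nat, gone) | S n => nxt (v n) end).
  assert (forall n, fst (v n) = n /\ ~ exists N, fin N (fst (v n)) (snd (v n))) as Hv.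
  { induction n as [|n [IH1 IH2]]; [split; auto|].
    destruct (Hnxt (v n) IH2) as (H1 & _ & H3). simpl. rewrite IH1 in H1. auto. }
  assert (forall n, Gam n (gmul (snd (v (S n))) (ginv (snd (v n))))) as Hray.
  { intros n. destruct (Hv n) as (H1 & H2). destruct (Hnxt (v n) H2) as (_ & H & _).
    rewrite H1 in H. exact H. }
  destruct (Hc (exist _ (fun n => snd (v n)) Hray)) as (i & Hi).
  destruct (c i) as [[m h]|] eqn:Hci; [|exact Hi].
  (* The ray built lies in piece [i], a shadow of level [m]. Its vertex at level [m] therefore has
     its whole shadow in that single piece. *)
  apply (Hv m). exists (S i). rewrite (proj1 (Hv m)). intros y Hy.
  exists i. split; [lia|]. rewrite Hci.
  exact (coset_eq_trans _ _ _ _ Hy Hi).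
Qed.

(** The ray through the cosets [Gam n g], which lets group elements serve as test points of the
    boundary. *)
Definition const_ray (g : G) : bdry :=
  exist (fun x => forall n, coset_eq n (x (S n)) (x n)) (fun _ => g)
    (fun n => coset_eq_refl n g).

(** Pass to a finite subcover and to a level [n] beyond all of its levels. There the indicators of
    the pieces sum to at least 1 at every point, and their averages are the costs. *)
Lemma covered_boundary_ge r : covered (fun _ => True) r -> 1 <= r.
Proof.
  intros (c & Hc & Hr).
  destruct (finite_subcover c) as (N & HN); [intros x; now apply Hc|].
  destruct (eventually_uniform_list
    (fun n i => match c i with None => True | Some (m, _) => (m <= n)%nat end)
    (seq 0 N)) as (n & Hn).
  - intros n m i Hnm. destruct (c i) as [[k g]|]; auto; lia.
  - intros i _. destruct (c i) as [[k g]|]; [exists k; auto|exists 0%nat; auto].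
  - set (F := fun i g => match c i with
                         | None => 0
                         | Some (m, h) => b2R (decb (coset_eq m g h)) end).
    assert (forall i g, 0 <= F i g) as HF.
    { intros i g. unfold F. destruct (c i) as [[m h]|]; [apply b2R_bounds|lra]. }
    apply Rle_trans with (rsum (fun i => avg n (F i)) (seq 0 N)).
    + rewrite <- avg_rsum, <- (avg_const n 1) at 1. apply avg_le. intros g.
      destruct (HN (const_ray g)) as (i & Hi & Hp).
      assert (1 = F i g) as ->.
      { unfold F. destruct (c i) as [[m h]|]; [|destruct Hp].
        rewrite (proj2 (decbP _)); [reflexivity|exact Hp]. }
      assert (F i g = rsum (fun j => F j g) (i :: nil)) as -> by (simpl; ring).
      apply rsum_incl; auto.
      * repeat constructor. intros [].
      * intros j [<-|[]]. apply in_seq. lia.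
    + eapply Rle_trans; [|apply (Hr N)]. apply rsum_le. intros i Hi.
      specialize (Hn i Hi). unfold F. destruct (c i) as [[m h]|]; simpl.
      * rewrite avg_coset_indicator_le by auto. lra.
      * rewrite avg_const. lra.
Qed.

Lemma mu_boundary : mu G Gam (fun _ => True) = 1.
Proof.
  apply Rle_antisym; [|apply le_mu, covered_boundary_ge].
  (* Reading 1 as an average shows that the cost of the root is at most 1: that cost is the average
     of an indicator. *)
  rewrite <- (avg_const 0 1).
  apply mu_le. apply (covered_sub _ (fun x => True) (/ INR (index G (Gam 0%nat)))); auto;
    [|apply covered_full].
  assert (avg 0 (fun g => b2R (decb (coset_eq 0 g gone))) = / INR (index G (Gam 0%nat)))
    as <- by (apply avg_coset_indicator_le; lia).
  apply avg_le. intros g. apply b2R_bounds.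
Qed.

Lemma mu_le_1 A : mu G Gam A <= 1.
Proof. rewrite <- mu_boundary. now apply mu_mono. Qed.

(** For invariant [P] this is a clopen set, a union of shadows of level [n]. *)
Definition cyl (n : nat) (P : G -> bool) : bdry -> Prop := fun x => P (x.[n]) = true.

Lemma cyl_level n m P x : invariant n P -> (n <= m)%nat -> (cyl m P x <-> cyl n P x).
Proof. intros HP Hnm. unfold cyl. rewrite (HP _ _ (rseq_coset_le x n m Hnm)). tauto. Qed.

Lemma covered_cyl n P : invariant n P ->
  covered (cyl n P) (avg n (fun g => b2R (P g))).
Proof.
  intros HP.
  assert (forall l, covered (fun x => exists r, In r l /\ P r = true /\ shadow G Gam n r x)
            (rsum (fun r => / INR (index G (Gam n)) * b2R (P r)) l)) as H.
  { induction l as [|a l IH].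
    - apply (covered_sub _ (fun _ => False) 0); [|simpl; lra|apply covered_empty].
      intros x (r & [] & _).
    - apply (covered_sub _ (fun x => (P a = true /\ shadow G Gam n a x) \/
               (exists r, In r l /\ P r = true /\ shadow G Gam n r x))
               (/ INR (index G (Gam n)) * b2R (P a) +
                rsum (fun r => / INR (index G (Gam n)) * b2R (P r)) l)).
      + intros x (r & [<-|Hr] & H1 & H2); [left; auto|right; now exists r].
      + simpl; lra.
      + apply covered_union2; [|exact IH]. destruct (P a); simpl.
        * apply (covered_sub _ (shadow G Gam n a) (/ INR (index G (Gam n)))); [tauto|lra|].
          apply covered_shadow.
        * apply (covered_sub _ (fun _ => False) 0); [easy|lra|apply covered_empty]. }
  specialize (H (reps n)). rewrite rsum_scal in H.
  refine (covered_sub _ _ _ _ _ _ H).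
  - intros x Hx. destruct (reps_cover n (x.[n])) as (r & Hr & Hxr).
    exists r. repeat split; auto. now rewrite <- (HP _ _ Hxr).
  - unfold avg, Rdiv. lra.
Qed.

(** The upper bounds for the cylinder and for its complement add up to 1, the total mass, so both
    are equalities. *)
Lemma mu_cyl n P : invariant n P -> mu G Gam (cyl n P) = avg n (fun g => b2R (P g)).
Proof.
  intros HP. apply Rle_antisym; [apply mu_le, covered_cyl, HP|].
  assert (mu G Gam (cyl n (fun g => negb (P g))) <= avg n (fun g => b2R (negb (P g)))) as H.
  { apply mu_le, covered_cyl. intros a b Hab. now rewrite (HP a b Hab). }
  rewrite (avg_ext _ _ (fun g => 1 - b2R (P g))) in H
    by (intros g; destruct (P g); simpl; ring).
  rewrite avg_minus, avg_const in H.
  assert (mu G Gam (fun _ => True) <=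
          mu G Gam (cyl n P) + mu G Gam (cyl n (fun g => negb (P g)))) as H'.
  { apply mu_sub_union. intros x _. unfold cyl. destruct (P (x.[n])); auto. }
  rewrite mu_boundary in H'. lra.
Qed.

Definition symdiff (A B : bdry -> Prop) : bdry -> Prop :=
  fun x => (A x /\ ~ B x) \/ (B x /\ ~ A x).

(** These sets turn out to form a sigma-algebra containing the shadows, hence to include all
    measurable sets. *)
Definition approximable (A : bdry -> Prop) : Prop :=
  forall e, 0 < e -> exists n P, invariant n P /\ covered (symdiff A (cyl n P)) e.

Lemma approximable_shadow n g : approximable (shadow G Gam n g).
Proof.
  intros e He. exists n, (fun h => decb (coset_eq n h g)).
  split; [apply coset_indicator_invariant|].
  apply (covered_sub _ (fun _ => False) 0); [|lra|apply covered_empty].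
  intros x. unfold symdiff, cyl. rewrite decbP. unfold shadow, coset_eq. tauto.
Qed.

Lemma approximable_compl A : approximable A -> approximable (fun x => ~ A x).
Proof.
  intros HA e He. destruct (HA e He) as (n & P & HP & Hc).
  exists n, (fun g => negb (P g)). split.
  - intros a b H. now rewrite (HP a b H).
  - refine (covered_sub _ _ _ _ _ (Rle_refl e) Hc).
    intros x. unfold symdiff, cyl. rewrite negb_true_iff.
    destruct (classic (A x)), (P (x.[n])); intuition congruence.
Qed.

(** A level beyond those of the first [N] cylinders, at which their union is again a cylinder. *)
Fixpoint union_level (n : nat -> nat) (N : nat) : nat :=
  match N with 0%nat => 0%nat | S N => Nat.max (union_level n N) (n N) end.

Fixpoint union_upto (P : nat -> G -> bool) (N : nat) (g : G) : bool :=
  match N with 0%nat => false | S N => union_upto P N g || P N g end.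

Lemma union_upto_invariant n P N : (forall i, invariant (n i) (P i)) ->
  invariant (union_level n N) (union_upto P N).
Proof.
  intros HP. induction N as [|N IH]; [easy|]. intros a b Hab. simpl in *.
  f_equal; [apply IH|apply HP]; eapply coset_eq_le; try exact Hab; lia.
Qed.

Lemma cyl_union_upto n P N x : (forall i, invariant (n i) (P i)) ->
  (cyl (union_level n N) (union_upto P N) x <-> exists i, (i < N)%nat /\ cyl (n i) (P i) x).
Proof.
  intros HP. induction N as [|N IH].
  - split; [easy|]. intros (i & Hi & _). lia.
  - unfold cyl in *. simpl. rewrite orb_true_iff.
    rewrite (union_upto_invariant n P N HP _ (x.[union_level n N]))
      by (apply rseq_coset_le; lia).
    rewrite (HP N _ (x.[n N])) by (apply rseq_coset_le; lia).
    rewrite IH. split.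
    + intros [(i & Hi & H)|H]; [exists i|exists N]; auto with arith.
    + intros (i & Hi & H). destruct (Nat.eq_dec i N) as [->|Hne]; auto.
      left; exists i; split; [lia|auto].
Qed.

(* The increments between successive finite unions are disjoint cylinders, so
   their measures are summable and the infinite union is close to a finite one. *)
Lemma covered_cyl_union_tail n P e : (forall i, invariant (n i) (P i)) -> 0 < e ->
  exists N, covered (fun x => (exists i, cyl (n i) (P i) x) /\
                     ~ cyl (union_level n N) (union_upto P N) x) e.
Proof.
  intros HP He.
  set (m := union_level n). set (U := union_upto P).
  assert (forall N, invariant (m N) (U N)) as HU by (intros N; now apply union_upto_invariant).
  set (u := fun N => avg (m N) (fun g => b2R (U N g))).
  set (D := fun N g => U (S N) g && negb (U N g)).
  assert (forall N, (m N <= m (S N))%nat) as Hm by (intros N; unfold m; simpl; lia).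
  assert (forall N, invariant (m (S N)) (D N)) as HD.
  { intros N a b Hab. unfold D. rewrite (HU (S N) a b Hab).
    now rewrite (invariant_le _ _ _ (Hm N) (HU N) a b Hab). }
  assert (forall N, avg (m (S N)) (fun g => b2R (D N g)) = u (S N) - u N) as HDu.
  { intros N. unfold u. rewrite <- (avg_level (m N) (m (S N)) (fun g => b2R (U N g))); auto.
    - rewrite <- avg_minus. apply avg_ext. intros g. unfold D, U. simpl.
      destruct (union_upto P N g), (P N g); simpl; ring.
    - intros a b Hab. now rewrite (HU N a b Hab). }
  destruct (bounded_increments_tail u 1 e) as (N & HN); auto.
  - intros N. assert (0 <= u (S N) - u N); [|lra].
    rewrite <- HDu, <- (avg_const (m (S N)) 0). apply avg_le. intros; apply b2R_bounds.
  - intros N. rewrite <- (avg_const (m N) 1). apply avg_le. intros; apply b2R_bounds.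
  - exists N.
    apply (covered_sub _ (fun x => exists i, cyl (m (S (N + i))) (D (N + i)%nat) x) e); [|lra|].
    + intros x ((i & Hi) & Hx).
      assert (exists k, cyl (m (N + k)%nat) (U (N + k)%nat) x) as (k & Hk).
      { exists (S i). apply cyl_union_upto; auto. exists i; split; [lia|auto]. }
      (* Find the step at which [x] enters the finite unions; it then lies in the corresponding
         increment. *)
      revert Hk. induction k as [|k IH].
      * rewrite Nat.add_0_r. contradiction.
      * intros Hk. destruct (classic (cyl (m (N + k)%nat) (U (N + k)%nat) x)) as [H|H]; auto.
        exists k. rewrite Nat.add_succ_r in Hk.
        rewrite <- (cyl_level (m (N + k)%nat) (m (S (N + k)))) in H; auto.
        unfold cyl, D in *. rewrite Hk. apply not_true_is_false in H. now rewrite H.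
    + apply (covered_union _ (fun i => u (S (N + i)) - u (N + i)%nat)).
      * intros i. rewrite <- HDu. now apply covered_cyl.
      * intros k. apply Rle_trans with (u (N + k)%nat - u N); [|apply HN; lia].
        induction k as [|k IH]; [rewrite Nat.add_0_r; simpl; lra|].
        rewrite seq_S, rsum_app, Nat.add_succ_r. simpl in *. lra.
Qed.

Lemma approximable_union (A : nat -> bdry -> Prop) :
  (forall i, approximable (A i)) -> approximable (fun x => exists i, A i x).
Proof.
  intros HA e He.
  (* Half of [e] is shared out geometrically among the approximations of the [A i]; the other half
     pays for truncating the union of cylinders. *)
  assert (forall i, exists p : nat * (G -> bool), invariant (fst p) (snd p) /\
    covered (symdiff (A i) (cyl (fst p) (snd p))) (e / 2 * (/ 2) ^ S i)) as H.
  { intros i. destruct (HA i (e / 2 * (/ 2) ^ S i)) as (n & P & H).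
    - apply Rmult_lt_0_compat; [lra|apply pow_lt; lra].
    - now exists (n, P). }
  destruct (ClassicalEpsilon.choice _ H) as (p & Hp).
  set (n := fun i => fst (p i)). set (P := fun i => snd (p i)).
  assert (forall i, invariant (n i) (P i)) as HP by (intros i; apply Hp).
  destruct (covered_cyl_union_tail n P (e / 2) HP) as (N & HN); [lra|].
  exists (union_level n N), (union_upto P N).
  split; [now apply union_upto_invariant|].
  apply (covered_sub _ (fun x => (exists i, symdiff (A i) (cyl (n i) (P i)) x) \/
     ((exists i, cyl (n i) (P i) x) /\ ~ cyl (union_level n N) (union_upto P N) x))
     (e / 2 + e / 2)); [|lra|].
  - intros x [[(i & Hi) Hx]|[Hx HnA]].
    + destruct (classic (cyl (n i) (P i) x)) as [Hc|Hc].
      * right; split; [now exists i|exact Hx].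
      * left; exists i; left; auto.
    + left. apply cyl_union_upto in Hx; auto. destruct Hx as (i & _ & Hi).
      exists i; right; split; auto. intros HAi; apply HnA; now exists i.
  - apply covered_union2; auto.
    apply (covered_union _ (fun i => e / 2 * (/ 2) ^ S i)); [intros i; apply Hp|].
    intros k. rewrite rsum_scal. pose proof (half_pow_sum k). nra.
Qed.

Lemma measurable_approximable A : measurable G Gam A -> approximable A.
Proof.
  intros H. apply H; [|exact approximable_shadow].
  split; [|split]; [|exact approximable_compl|exact approximable_union].
  intros e He. exists 0%nat, (fun _ => true). split; [easy|].
  apply (covered_sub _ (fun _ => False) 0); [|lra|apply covered_empty].
  intros x. unfold symdiff, cyl. tauto.
Qed.

Lemma measurable_compl A : measurable G Gam A -> measurable G Gam (fun x => ~ A x).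
Proof. intros H S HS Hsh. apply (proj1 (proj2 HS)). now apply H. Qed.

Lemma measurable_cyl n P : invariant n P -> measurable G Gam (cyl n P).
Proof.
  intros HP S (Ht & Hn & Hu) Hsh.
  (* The finite union of shadows is padded to a countable one. The empty set is written [~ True]
     because a sigma-algebra provides it as the complement of the whole space. *)
  assert (cyl n P = fun x => exists i, match nth_error (reps n) i with
            | Some r => if P r then shadow G Gam n r else fun _ => ~ True
            | None => fun _ => ~ True end x) as ->.
  { apply functional_extensionality; intros x. apply propositional_extensionality. split.
    - intros Hx. destruct (reps_cover n (x.[n])) as (r & Hr & Hxr).
      destruct (In_nth_error _ _ Hr) as (i & Hi). exists i. rewrite Hi.
      unfold cyl in Hx. rewrite (HP _ _ Hxr) in Hx. rewrite Hx. exact Hxr.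
    - intros (i & Hi). destruct (nth_error (reps n) i) as [r|]; [|tauto].
      destruct (P r) eqn:Hr; [|tauto]. unfold cyl. now rewrite (HP _ _ Hi). }
  apply Hu. intros i. destruct (nth_error (reps n) i) as [r|]; [|now apply Hn].
  destruct (P r); [apply Hsh|now apply Hn].
Qed.

Lemma measurable_cyl_approx A e : measurable G Gam A -> 0 < e ->
  exists n P, invariant n P /\ mu G Gam (symdiff A (cyl n P)) <= e.
Proof.
  intros HA He. destruct (measurable_approximable A HA e He) as (n & P & HP & Hc).
  exists n, P. split; [exact HP|now apply mu_le].
Qed.

(** An outer measure is only subadditive; the missing inequality holds exactly for cylinders and
    passes to [A] by approximation. *)
Lemma mu_compl A : measurable G Gam A -> mu G Gam (fun x => ~ A x) = 1 - mu G Gam A.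
Proof.
  intros HA. apply Rle_antisym.
  - apply le_epsilon. intros e He.
    destruct (measurable_cyl_approx A (e / 2) HA) as (n & P & HP & Hs); [lra|].
    assert (mu G Gam A <= mu G Gam (cyl n P) + mu G Gam (symdiff A (cyl n P))) as H1.
    { apply mu_sub_union. intros x Hx. unfold symdiff.
      destruct (classic (cyl n P x)); auto. }
    set (Q := fun g => negb (P g)).
    assert (mu G Gam (fun x => ~ A x) <=
            mu G Gam (cyl n Q) + mu G Gam (symdiff A (cyl n P))) as H2.
    { apply mu_sub_union. intros x Hx. unfold symdiff, cyl, Q.
      destruct (P (x.[n])); auto. }
    assert (mu G Gam (cyl n Q) = 1 - mu G Gam (cyl n P)) as H3.
    { rewrite !mu_cyl; auto.
      - rewrite <- (avg_const n 1) at 1. rewrite <- avg_minus. apply avg_ext.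
        intros g. unfold Q. destruct (P g); simpl; ring.
      - intros a b Hab. unfold Q. now rewrite (HP a b Hab). }
    lra.
  - assert (mu G Gam (fun _ => True) <= mu G Gam A + mu G Gam (fun x => ~ A x)) as H.
    { apply mu_sub_union. intros x _. apply classic. }
    rewrite mu_boundary in H. lra.
Qed.

(** * Spectral gap and strong ergodicity *)

Lemma avg_exists_ge n f : exists g, avg n f <= f g.
Proof.
  apply NNPP. intros H.
  assert (forall l : list G, l <> nil -> 0 < rsum (fun g => avg n f - f g) l) as Hpos.
  { intros l Hl. destruct l as [|a l]; [easy|]. simpl.
    assert (forall g, f g < avg n f) as Hlt.
    { intros g. apply Rnot_le_lt. intros Hg. apply H. now exists g. }
    pose proof (Hlt a).
    assert (0 <= rsum (fun g => avg n f - f g) l); [|lra].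
    apply rsum_nonneg. intros g _. pose proof (Hlt g). lra. }
  assert (avg n (fun g => avg n f - f g) = 0) as H0.
  { rewrite avg_minus, avg_const. ring. }
  unfold avg at 1 in H0. pose proof (index_pos n) as Hi.
  assert (0 < rsum (fun g => avg n f - f g) (reps n)) as Hr.
  { apply Hpos. destruct (reps_cover n gone) as (r & Hr & _). intros Hnil.
    rewrite Hnil in Hr. destruct Hr. }
  pose proof (Rdiv_lt_0_compat _ _ Hr Hi). lra.
Qed.

(** * Spreading a cylinder by left translates *)

Definition density (n : nat) (P : G -> bool) : R := avg n (fun g => b2R (P g)).

(** The measure of the part of the cylinder's translate by [c] that leaves the cylinder, as
    [mu_drift] confirms. *)
Definition drift (n : nat) (P : G -> bool) (c : G) : R :=
  density n (fun g => P (gmul g (ginv c)) && negb (P g)).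

Lemma density_bounds n P : 0 <= density n P <= 1.
Proof.
  split; [rewrite <- (avg_const n 0)|rewrite <- (avg_const n 1)]; apply avg_le;
    intros; apply b2R_bounds.
Qed.

(** For fixed [x], the average of [P (g^-1 x)] over [g] is the density of [P]. Exchanging the two
    averages, the mean over [g] of the right-hand side equals the left-hand side, so some [g]
    reaches it. *)
Lemma exists_spreading_translate n P U : invariant n P -> invariant n U ->
  exists g, density n P * (1 - density n U) <=
            density n (fun x => P (gmul (ginv g) x) && negb (U x)).
Proof.
  intros HP HU.
  destruct (avg_exists_ge n
    (fun g => density n (fun x => P (gmul (ginv g) x) && negb (U x)))) as (g & Hg).
  exists g. eapply Rle_trans; [|exact Hg]. apply Req_le.
  unfold density at 3. rewrite avg_swap.
  rewrite (avg_ext _ _ (fun x => density n P * (1 - b2R (U x)))).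
  - rewrite avg_scal, avg_minus, avg_const. reflexivity.
  - intros x.
    rewrite (avg_ext _ _ (fun y => (1 - b2R (U x)) * b2R (P (gmul (ginv y) x)))).
    + rewrite avg_scal, (avg_inv_mulr n (fun y => b2R (P y))).
      * unfold density; ring.
      * intros a b Hab. now rewrite (HP a b Hab).
    + intros y. destruct (P (gmul (ginv y) x)), (U x); simpl; ring.
Qed.

(* Left translations commute with the right action and preserve density, so
   each added translate increases the drift by at most that of [P]. *)
Lemma greedy_translates n P j : invariant n P -> density n P <= 5 / 8 ->
  exists U i, invariant n U /\ density n U <= 5 / 8 /\
    (forall c, drift n U c <= INR i * drift n P c) /\
    ((1 / 4 <= density n U /\ (INR i - 1) * density n P <= 1 / 3) \/
     (density n U < 1 / 4 /\ i = j /\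
      3 / 4 * (INR j * density n P) <= density n U <= INR j * density n P)).
Proof.
  intros HP Hb. pose proof (density_bounds n P) as Hb0.
  induction j as [|j (U & i & HU & HU58 & Hd & Hcase)].
  - assert (density n (fun _ => false) = 0) as H0 by exact (avg_const n 0).
    exists (fun _ => false), 0%nat. rewrite H0.
    split; [easy|]. split; [lra|]. split.
    + intros c. unfold drift. simpl. rewrite H0. lra.
    + right. simpl. repeat split; lra.
  - destruct Hcase as [Hdone|(Hlt & -> & Hlo & Hhi)]; [exists U, i; tauto|].
    destruct (exists_spreading_translate n P U HP HU) as (g & Hg).
    set (Pg := fun x => P (gmul (ginv g) x)) in *.
    assert (invariant n Pg) as HPg by (now apply invariant_mull).
    assert (density n Pg = density n P) as HPgd.
    { apply (avg_mull n (fun x => b2R (P x))). intros a b Hab. now rewrite (HP a b Hab). }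
    assert (density n (fun x => U x || Pg x) =
            density n U + density n (fun x => Pg x && negb (U x))) as Hadd.
    { unfold density. rewrite <- avg_plus. apply avg_ext. intros x.
      destruct (U x), (Pg x); simpl; ring. }
    assert (density n (fun x => Pg x && negb (U x)) <= density n P) as Hle.
    { rewrite <- HPgd. apply avg_le. intros x. destruct (U x), (Pg x); simpl; lra. }
    change (density n (fun x => P (gmul (ginv g) x) && negb (U x)))
      with (density n (fun x => Pg x && negb (U x))) in Hg.
    exists (fun x => U x || Pg x), (S j).
    rewrite Hadd, S_INR.
    set (q := density n (fun x => Pg x && negb (U x))) in *.
    (* As long as [U] has density below 1/4, at least 3/4 of the new translate can be made to fall
       outside it. *)
    assert (3 / 4 * density n P <= q) as Hq by nra.
    split; [|split; [|split]].
    + intros a b Hab. now rewrite (HU a b Hab), (HPg a b Hab).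
    + destruct j as [|j]; [simpl in Hhi; lra|].
      rewrite S_INR in Hlo. pose proof (pos_INR j). nra.
    + intros c. apply Rle_trans with (drift n U c + drift n Pg c).
      * unfold drift, density. rewrite <- avg_plus. apply avg_le. intros x.
        destruct (U (gmul x (ginv c))), (U x), (Pg (gmul x (ginv c))), (Pg x); simpl; lra.
      * assert (drift n Pg c = drift n P c) as ->.
        { unfold drift, density, Pg.
          rewrite (avg_ext n _ (fun g0 =>
            (fun x => b2R (P (gmul x (ginv c)) && negb (P x))) (gmul (ginv g) g0)))
            by (intros x; now rewrite gmulA).
          apply (avg_mull n (fun x => b2R (P (gmul x (ginv c)) && negb (P x)))).
          intros a b Hab. rewrite (HP a b Hab).
          now rewrite (invariant_mulr n P (ginv c) HP a b Hab). }
        specialize (Hd c). lra.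
    + destruct (Rlt_le_dec (density n U + q) (1 / 4)) as [Hs|Hs].
      * right. repeat split; auto; lra.
      (* Before the last step the density was below 1/4 and at least 3/4 of [INR j * density n P],
         which gives the bound 1/3. *)
      * left. split; [lra|]. replace (INR j + 1 - 1) with (INR j) by ring. lra.
Qed.

(** With [INR j * density n P > 1] the unfinished alternative would give a density above 3/4 and
    below 1/4. Otherwise [INR i * density n P] is at most 1/3 + 5/8 < 1. *)
Lemma saturate n P : invariant n P -> 0 < density n P <= 5 / 8 ->
  exists U i, invariant n U /\ 1 / 4 <= density n U <= 5 / 8 /\
    INR i * density n P <= 1 /\ (forall c, drift n U c <= INR i * drift n P c).
Proof.
  intros HP Hb.
  destruct (INR_archimed (density n P) 1) as (j & Hj); [lra|].
  destruct (greedy_translates n P j HP) as (U & i & HU & H58 & Hd & Hcase); [lra|].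
  exists U, i. destruct Hcase as [[H1 H2]|(H1 & _ & H2)]; [|lra].
  repeat split; auto; lra.
Qed.

Lemma mu_drift n P c : invariant n P ->
  mu G Gam (setD (translate G Gam (cyl n P) c) (cyl n P)) = drift n P c.
Proof.
  intros HP. unfold drift, density. rewrite <- mu_cyl.
  - apply mu_ext. intros x. unfold setD, translate, cyl.
    rewrite rseq_ract, andb_true_iff, negb_true_iff, not_true_iff_false. reflexivity.
  - intros a b Hab. rewrite (HP a b Hab).
    now rewrite (invariant_mulr n P (ginv c) HP a b Hab).
Qed.

(** A point counted for [B] but not for [A] lies in the symmetric difference or in its translate,
    which have equal measure. *)
Lemma mu_drift_symdiff A B c :
  mu G Gam (setD (translate G Gam B c) B) <=
  mu G Gam (setD (translate G Gam A c) A) + 2 * mu G Gam (symdiff A B).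
Proof.
  eapply Rle_trans.
  - apply (mu_sub_union _ (setD (translate G Gam A c) A)
      (fun x => symdiff A B x \/ translate G Gam (symdiff A B) c x)).
    intros x [H1 H2]. unfold setD, symdiff, translate in *.
    destruct (classic (A x)), (classic (A (ract G Gam x (ginv c)))); tauto.
  - pose proof (mu_union (symdiff A B) (translate G Gam (symdiff A B) c)) as H.
    rewrite mu_translate in H. lra.
Qed.

Lemma spread_almost_invariant A r : measurable G Gam A -> 0 < mu G Gam A <= / 2 ->
  0 < r <= 1 ->
  exists n U, invariant n U /\ 1 / 4 <= mu G Gam (cyl n U) <= 5 / 8 /\
    forall c, mu G Gam (setD (translate G Gam (cyl n U) c) (cyl n U)) <=
      4 / 3 * (mu G Gam (setD (translate G Gam A c) A) / mu G Gam A + r / 2).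
Proof.
  intros HA Ha Hr. set (a := mu G Gam A) in *.
  (* The error is relative to [a]. Since [r <= 1] and [a <= 1/2], the density of [P] is at least
     [3/4 a], which yields the factor 4/3, and at most [5/4 a <= 5/8]. The drift grows by at most
     [a r / 2]. *)
  destruct (measurable_cyl_approx A (a * r / 4) HA) as (n & P & HP & Hs); [nra|].
  assert (a <= density n P + mu G Gam (symdiff A (cyl n P))) as H1.
  { unfold density. rewrite <- mu_cyl by auto. apply mu_sub_union. intros x Hx.
    unfold symdiff. destruct (classic (cyl n P x)); auto. }
  assert (density n P <= a + mu G Gam (symdiff A (cyl n P))) as H2.
  { unfold density. rewrite <- mu_cyl by auto. apply mu_sub_union. intros x Hx.
    unfold symdiff. destruct (classic (A x)); auto. }
  destruct (saturate n P HP) as (U & i & HU & HUd & Hi & Hd); [nra|].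
  exists n, U. split; [exact HU|]. split; [now rewrite mu_cyl|].
  intros c. rewrite mu_drift by auto.
  eapply Rle_trans; [apply Hd|].
  rewrite <- mu_drift by auto.
  pose proof (mu_drift_symdiff A (cyl n P) c) as H3.
  set (t := mu G Gam (setD (translate G Gam A c) A)) in *.
  assert (0 <= t) by apply mu_nonneg.
  assert (0 <= t / a) by (apply Rle_mult_inv_pos; lra).
  replace (t / a + r / 2) with ((t + a * r / 2) * / a) by (field; lra).
  assert (0 <= INR i) by apply pos_INR.
  assert (INR i * a <= 4 / 3) by nra.
  apply Rle_trans with (INR i * (t + a * r / 2)); [apply Rmult_le_compat_l; lra|].
  replace (4 / 3 * ((t + a * r / 2) * / a)) with (4 / 3 * / a * (t + a * r / 2)) by ring.
  apply Rmult_le_compat_r; [nra|].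
  apply Rmult_le_reg_r with a; [lra|]. rewrite Rmult_assoc, Rinv_l; lra.
Qed.

Lemma strongly_ergodic_spectral_gap : strongly_ergodic G Gam -> spectral_gap G Gam.
Proof.
  intros [_ HSE] (A & HA & HAc).
  assert (forall k, exists p : nat * (G -> bool), invariant (fst p) (snd p) /\
    1 / 4 <= mu G Gam (cyl (fst p) (snd p)) <= 5 / 8 /\
    forall c, mu G Gam (setD (translate G Gam (cyl (fst p) (snd p)) c)
                             (cyl (fst p) (snd p))) <=
      4 / 3 * (mu G Gam (setD (translate G Gam (A k) c) (A k)) / mu G Gam (A k)
               + RinvN k / 2)) as H.
  { intros k. destruct (HA k) as [HAm HAk].
    destruct (spread_almost_invariant (A k) (RinvN k) HAm HAk) as (n & U & HU).
    - split; [apply cond_pos|]. simpl. rewrite <- Rinv_1. apply Rinv_le_contravar; [lra|].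
      pose proof (pos_INR k). lra.
    - now exists (n, U). }
  destruct (ClassicalEpsilon.choice _ H) as (p & Hp).
  (* For [m] between 1/4 and 5/8 the product [m (1 - m)] is at least 3/16, so it cannot drop below
     3/32. *)
  destruct (HSE (fun k => cyl (fst (p k)) (snd (p k)))) with (eps := 3 / 32) as (N & HN).
  - intros k. apply measurable_cyl, Hp.
  - intros c e He.
    destruct (HAc (ginv c) (e / 4)) as (N1 & HN1); [lra|].
    destruct (@RinvN_cv (e / 4)) as (N2 & HN2); [lra|].
    exists (Nat.max N1 N2). intros k Hk.
    specialize (HN1 k ltac:(lia)). specialize (HN2 k ltac:(lia)).
    unfold Rdist in *. rewrite Rminus_0_r in *.
    rewrite mu_setD_translate, Rabs_right by (apply Rle_ge, mu_nonneg).
    eapply Rle_lt_trans; [apply Hp|].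
    apply Rabs_def2 in HN1, HN2. lra.
  - lra.
  - specialize (HN N (le_n N)). unfold Rdist in HN. rewrite Rminus_0_r in HN.
    destruct (Hp N) as (_ & Hm & _). apply Rabs_def2 in HN. nra.
Qed.

(** * From spectral gap to strong ergodicity *)

Lemma setD_translate_compl A c x :
  setD (translate G Gam (fun y => ~ A y) c) (fun y => ~ A y) x <->
  setD A (translate G Gam A c) x.
Proof. unfold setD, translate. destruct (classic (A x)); tauto. Qed.

(** [B] is [A] or its complement, whichever has measure at most 1/2. The drift of [B] is one of the
    two terms on the right, depending on the case; their sum covers both. *)
Lemma small_of_compl A : measurable G Gam A ->
  exists B, measurable G Gam B /\ mu G Gam B <= / 2 /\
    mu G Gam A * (1 - mu G Gam A) <= mu G Gam B /\
    forall c, mu G Gam (setD (translate G Gam B c) B) <=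
      mu G Gam (setD A (translate G Gam A (ginv c))) +
      mu G Gam (setD A (translate G Gam A c)).
Proof.
  intros HA. pose proof (mu_nonneg A). pose proof (mu_le_1 A).
  destruct (Rle_dec (mu G Gam A) (/ 2)) as [Hs|Hs].
  - exists A. repeat split; auto; [nra|]. intros c.
    rewrite (mu_setD_translate A (ginv c)), ginv_invol.
    pose proof (mu_nonneg (setD A (translate G Gam A c))). lra.
  - exists (fun x => ~ A x). rewrite mu_compl by auto.
    repeat split; [now apply measurable_compl|lra|nra|].
    intros c. rewrite (mu_ext _ _ (setD_translate_compl A c)).
    pose proof (mu_nonneg (setD A (translate G Gam A (ginv c)))). lra.
Qed.

Lemma spectral_gap_no_almost_invariant (A : nat -> bdry -> Prop) (d : R) :
  spectral_gap G Gam -> 0 < d -> (forall k, measurable G Gam (A k)) ->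
  (forall k, d <= mu G Gam (A k) * (1 - mu G Gam (A k))) ->
  ~ forall c, Un_cv (fun k => mu G Gam (setD (A k) (translate G Gam (A k) c))) 0.
Proof.
  intros HSG Hd HA Hlow Hcv.
  destruct (ClassicalEpsilon.choice _ (fun k => small_of_compl (A k) (HA k))) as (B & HB).
  assert (forall k, d <= mu G Gam (B k)) as HBd.
  { intros k. eapply Rle_trans; [apply Hlow|apply HB]. }
  apply HSG. exists B. split.
  - intros k. destruct (HB k) as (H1 & H2 & _). specialize (HBd k). repeat split; auto; lra.
  - intros c e He.
    (* The two drift terms together stay below [e * d], hence below [e] times the measure of
       [B k]. *)
    destruct (Hcv c (e * d / 2)) as (N1 & HN1); [nra|].
    destruct (Hcv (ginv c) (e * d / 2)) as (N2 & HN2); [nra|].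
    exists (Nat.max N1 N2). intros k Hk.
    specialize (HN1 k ltac:(lia)). specialize (HN2 k ltac:(lia)).
    unfold Rdist in *. rewrite Rminus_0_r in *.
    apply Rabs_def2 in HN1, HN2.
    destruct (HB k) as (_ & _ & _ & Hk'). specialize (Hk' c). specialize (HBd k).
    set (t := mu G Gam (setD (translate G Gam (B k) c) (B k))) in *.
    assert (0 <= t) by apply mu_nonneg.
    rewrite Rabs_right by (apply Rle_ge, Rle_mult_inv_pos; lra).
    apply Rmult_lt_reg_r with (mu G Gam (B k)); [lra|].
    unfold Rdiv. rewrite Rmult_assoc, Rinv_l by lra. nra.
Qed.

Lemma spectral_gap_strongly_ergodic : spectral_gap G Gam -> strongly_ergodic G Gam.
Proof.
  intros HSG. split.
  - intros A HA Hinv. pose proof (mu_nonneg A). pose proof (mu_le_1 A).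
    apply NNPP. intros Hn.
    assert (0 < mu G Gam A * (1 - mu G Gam A)) as Hpos.
    { apply Rmult_lt_0_compat.
      - destruct (Req_dec (mu G Gam A) 0); [tauto|lra].
      - destruct (Req_dec (mu G Gam A) 1); [tauto|lra]. }
    (* An invariant set of intermediate measure is a constant almost invariant sequence. *)
    apply (spectral_gap_no_almost_invariant (fun _ => A) _ HSG Hpos); auto; [intros; lra|].
    intros c e He. exists 0%nat. intros _ _.
    rewrite (mu_ext _ (fun _ => False)).
    + assert (mu G Gam (fun _ => False) = 0) as ->.
      { apply Rle_antisym; [apply mu_le, covered_empty|apply mu_nonneg]. }
      unfold Rdist. rewrite Rminus_0_r, Rabs_R0. exact He.
    + intros x. unfold setD. rewrite Hinv. tauto.
  - intros A HA Hcv. apply NNPP. intros Hn.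
    (* Failure of convergence gives indices [s N >= N] along which the product stays at least [d];
       almost invariance survives this reindexing. *)
    assert (exists d, 0 < d /\ forall N, exists k, (N <= k)%nat /\
              d <= mu G Gam (A k) * (1 - mu G Gam (A k))) as (d & Hd & Hfreq).
    { apply NNPP. intros Hno. apply Hn. intros e He. apply NNPP. intros HN.
      apply Hno. exists e. split; [exact He|]. intros N. apply NNPP. intros Hk.
      apply HN. exists N. intros k HNk. unfold Rdist. rewrite Rminus_0_r.
      pose proof (mu_nonneg (A k)). pose proof (mu_le_1 (A k)).
      rewrite Rabs_right by nra. apply Rnot_le_lt. intros Hek. apply Hk. now exists k. }
    destruct (ClassicalEpsilon.choice _ Hfreq) as (s & Hs).
    apply (spectral_gap_no_almost_invariant (fun N => A (s N)) d HSG Hd).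
    + intros k; auto.
    + intros k; apply Hs.
    + intros c e He. destruct (Hcv c e He) as (N & HN). exists N. intros k Hk.
      apply HN. destruct (Hs k) as [Hk' _]. lia.
Qed.

End Chain.

Theorem theorem4 (G : Group) (Gam : nat -> G -> Prop) :
  finitely_generated G -> normal_chain G Gam ->
  (strongly_ergodic G Gam <-> spectral_gap G Gam).
Proof.
  intros _ chain. split.
  - now apply strongly_ergodic_spectral_gap.
  - now apply spectral_gap_strongly_ergodic.
Qed.
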